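(* Let $n_1,\dots,n_k$ be positive integers, $L=\operatorname{lcm}(n_1,\dots,n_k)$, and $A=\prod_{j=1}^k\mathbb{Z}/n_j\mathbb{Z}$. Then $$\frac1L\sum_{l=1}^{L}\gcd(l,n_1)\gcd(l,n_2)\cdots\gcd(l,n_k)=\sum_{a\in A}\frac{1}{|a|},$$ where $|a|$ denotes the order of the element $a\in A$. (Every finite abelian group is of this form, so this holds for every finite abelian group $A$.) *)

(* Defs.v *)
From HB Require Import structures.
From mathcomp Require Import all_boot all_order all_algebra all_fingroup.
From mathcomp Require Import all_solvable.

Set Implicit Arguments.
Unset Strict Implicit.
Unset Printing Implicit Defensive.

Import GRing.Theory.

(* The ring type 'Z_m is Z/2Z for m = 1, so Z/mZ is taken to be the additive
   group of integers mod m on 'I_m.-1.+1, which is correct for every m > 0.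
   The canonical finGroupType on {dffun _} is the direct product. *)
Definition prod_Zmod (k : nat) (n : 'I_k -> nat) : finGroupType :=
  {dffun forall j : 'I_k, 'I_(n j).-1.+1}.

Definition lcm_of (k : nat) (n : 'I_k -> nat) : nat :=
  (\big[lcmn/1]_(j < k) n j)%N.

Local Open Scope ring_scope.

Definition mean_gcd_prod (k : nat) (n : 'I_k -> nat) : rat :=
  (lcm_of n)%:R^-1 *
    \sum_(1 <= l < (lcm_of n).+1) \prod_(j < k) (gcdn l (n j))%:R.

(* Main.v *)
Require Import Defs.
From mathcomp Require Import all_boot all_order all_algebra all_fingroup.
From mathcomp Require Import all_solvable.

(** Count the pairs [(l, a)] with [1 <= l <= L], [a] in [A] and [l a = 0] in
    two ways.  For fixed [l] the equation [l x = 0] has [gcd(l, n_j)] solutions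
    in [Z/n_j], so there are [\prod_j gcd(l, n_j)] such [a]; for fixed [a] the
    admissible [l] are the multiples of [|a|] up to [L], and [|a|] divides [L],
    so there are [L / |a|] of them. *)

Import GRing.Theory Num.Theory.

Local Open Scope ring_scope.

Lemma sum_dvdn_ord (d q : nat) :
  (0 < d)%N -> (\sum_(i < d * q) (d %| i) = q)%N.
Proof.
move=> d_gt0; case: q => [|q]; first by rewrite muln0 big_ord0.
rewrite -(big_mkord xpredT (fun i => (d %| i) : nat)).
rewrite big_ltn ?muln_gt0 ?d_gt0 // dvdn0 addnC.
(* The term of index 0 is traded for the equal term of index [d * q.+1]: the range now starts at 1,
   as [divn_count_dvd] requires. *)
rewrite -[X in (_ + nat_of_bool X)%N](dvdn_mulr q.+1 (dvdnn d)).
by rewrite -big_nat_recr ?muln_gt0 ?d_gt0 //= -divn_count_dvd mulKn.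
Qed.

(** Write [g] for the gcd. The group law is addition mod [p.+1], so [x] is counted when [p.+1]
    divides [x * l]. As [p.+1 %/ g] and [l %/ g] are coprime, this means that [p.+1 %/ g] divides
    [x], and it has [g] multiples below [p.+1]. *)
Lemma card_Zp_torsion (p l : nat) :
  #|[set x : 'I_p.+1 | x ^+ l == 1]%g| = gcdn l p.+1.
Proof.
set g := gcdn l p.+1; have g_gt0 : (0 < g)%N by rewrite gcdn_gt0 orbT.
have Dp : (p.+1 %/ g * g = p.+1)%N by rewrite divnK ?dvdn_gcdr.
have d_gt0 : (0 < p.+1 %/ g)%N by rewrite divn_gt0 // dvdn_leq ?dvdn_gcdr.
have cop : coprime (p.+1 %/ g) (l %/ g).
  rewrite /coprime -(eqn_pmul2r g_gt0) muln_gcdl mul1n !divnK ?dvdn_gcdl //.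
    by rewrite gcdnC.
  exact: dvdn_gcdr.
rewrite -[RHS](sum_dvdn_ord (p.+1 %/ g)) // Dp -sum1_card big_mkcond /=.
apply: eq_bigr => x _; rewrite inE Zp_expg.
have -> : (inZp (x * l) == 1 :> 'I_p.+1)%g = (p.+1 %| x * l)%N.
  by rewrite -val_eqE.
rewrite -{1}Dp -{1}(divnK (dvdn_gcdl l p.+1)) -/g mulnA dvdn_pmul2r //.
by rewrite Gauss_dvdl //; case: (_ %| _)%N.
Qed.

Section ProdZmod.

Variables (k : nat) (n : 'I_k -> nat).
Hypothesis n_gt0 : forall j, (0 < n j)%N.

Lemma prod_ZmodX (a : prod_Zmod n) (l : nat) (j : 'I_k) :
  (a ^+ l)%g j = (a j ^+ l)%g.
Proof.
elim: l => [|l IHl]; first by rewrite !expg0 ffunE.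
by rewrite !expgS ffunE IHl.
Qed.

Lemma prod_Zmod_expg_eq1 (a : prod_Zmod n) (l : nat) :
  (a ^+ l == 1)%g = [forall j, a j ^+ l == 1]%g.
Proof.
apply/eqP/forallP => [al1 j | al1].
  by rewrite -prod_ZmodX al1 ffunE.
by apply/ffunP => j; rewrite prod_ZmodX ffunE; apply/eqP/al1.
Qed.

Lemma card_prod_Zmod_torsion (l : nat) :
  #|[set a : prod_Zmod n | a ^+ l == 1]%g| = (\prod_(j < k) gcdn l (n j))%N.
Proof.
have -> : [set a : prod_Zmod n | a ^+ l == 1]%g
        = setXn (fun j => [set x : 'I_(n j).-1.+1 | x ^+ l == 1]%g).
  apply/setP => a; rewrite !inE prod_Zmod_expg_eq1.
  by apply: eq_forallb => j; rewrite inE.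
by rewrite cardsXn; apply: eq_bigr => j _; rewrite card_Zp_torsion prednK.
Qed.

Lemma card_prod_Zmod : #|[set: prod_Zmod n]| = (\prod_(j < k) n j)%N.
Proof.
have -> : [set: prod_Zmod n] = setXn (fun j => [set: 'I_(n j).-1.+1]).
  by apply/setP => a; rewrite !inE; apply/esym/forallP => j; rewrite inE.
by rewrite cardsXn; apply: eq_bigr => j _; rewrite cardsT card_ord prednK.
Qed.

Lemma lcm_of_gt0 : (0 < lcm_of n)%N.
Proof. by rewrite /lcm_of; elim/big_ind: _ => // x y x0 y0; rewrite lcmn_gt0 x0. Qed.

(** By Lagrange the order of each coordinate divides [n j], so the lcm kills every coordinate. *)
Lemma order_prod_Zmod_dvd (a : prod_Zmod n) : (#[a]%g %| lcm_of n)%N.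
Proof.
rewrite order_dvdn prod_Zmod_expg_eq1; apply/forallP => j.
rewrite -order_dvdn; apply: (@dvdn_trans (n j)); last exact: biglcmn_sup.
by rewrite -[X in (_ %| X)%N](prednK (n_gt0 j)) -[X in (_ %| X)%N]card_ord
           -cardsT order_dvdG ?inE.
Qed.

Lemma mean_gcd_prodE :
  mean_gcd_prod n = \sum_(a : prod_Zmod n) (#[a]%g)%:R^-1.
Proof.
have L_neq0 : (lcm_of n)%:R != 0 :> rat by rewrite pnatr_eq0 -lt0n lcm_of_gt0.
apply: (mulfI L_neq0); rewrite /mean_gcd_prod mulrA divff // mul1r.
transitivity (\sum_(1 <= l < (lcm_of n).+1)
                \sum_(a : prod_Zmod n) (#[a]%g %| l)%:R : rat).
  apply: eq_bigr => l _; rewrite -natr_prod -card_prod_Zmod_torsion.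
  rewrite -natr_sum -sum1_card big_mkcond /=; congr _%:R.
  by apply: eq_bigr => a _; rewrite inE order_dvdn; case: eqP.
(* For fixed [a] the inner sum is a natural-number quotient; it equals the rational one because the
   order of [a] divides the lcm. *)
rewrite exchange_big mulr_sumr; apply: eq_bigr => a _ /=.
rewrite -natr_sum -divn_count_dvd natf_div ?order_prod_Zmod_dvd //.
Qed.

End ProdZmod.

(** Commutativity holds only inside [G], so induction on [r] moves each [g i] past the product of
    the later [f] values. This makes the map of the next lemma a morphism. *)
Lemma prodgM_abelian (gT : finGroupType) (G : {group gT}) (I : Type)
    (r : seq I) (f g : I -> gT) :
  abelian G -> (forall i, f i \in G) -> (forall i, g i \in G) ->
  (\prod_(i <- r) (f i * g i) = \prod_(i <- r) f i * \prod_(i <- r) g i)%g.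
Proof.
move=> cGG Gf Gg; elim: r => [|i r IHr]; first by rewrite !big_nil mulg1.
rewrite !big_cons IHr -!mulgA; congr (_ * _)%g; rewrite !mulgA.
congr (_ * _)%g; apply: (centsP cGG) => //.
exact: group_prod.
Qed.

(* The map [a |-> \prod_j b_j ^+ a_j] is onto, hence bijective by cardinality. *)
Lemma bigdprod_cycle_isog (gT : finGroupType) (G : {group gT}) (k : nat)
    (b : 'I_k -> gT) :
  abelian G -> \big[dprod/1%g]_(j < k) <[b j]>%g = G ->
  G \isog [set: prod_Zmod (fun j => #[b j]%g)].
Proof.
move=> cGG defG; set n := fun j => #[b j]%g.
have n_gt0 j : (0 < n j)%N by apply: order_gt0.
have Gb j : b j \in G.
  by rewrite -(bigdprodWY defG) mem_gen // (bigD1 j) //= inE cycle_id.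
pose f (a : prod_Zmod n) := (\prod_(j < k) b j ^+ a j)%g.
have fM : {in [set: prod_Zmod n] &, {morph f : x y / x * y}}%g.
  move=> x y _ _; rewrite /f -(prodgM_abelian _ G) //; last 2 first.
  - by move=> j; rewrite groupX.
  - by move=> j; rewrite groupX.
  apply: eq_bigr => j _; rewrite ffunE -expgD /=.
  (* Coordinates add modulo the order of [b j], which leaves the power unchanged. *)
  by rewrite [X in (_ %% X)%N]prednK // expg_mod_order.
rewrite isogEcard card_prod_Zmod // -(bigdprod_card defG) leqnn andbT.
apply/homgP; exists (Morphism fM).
apply/setP => x; apply/morphimP/idP => [[a _ _ ->] | ].
  by apply: group_prod => j _; rewrite groupX.
rewrite -(bigdprodW defG) => /prodsgP[c cb ->].
(* Stated with a boolean equality so that [xchoose] can assemble the exponents into a preimage. *)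
have cX j : exists m : 'I_(n j).-1.+1, (c j == b j ^+ m)%g.
  have /cyclePmin[m lt_m ->] := cb j isT.
  have lt_m' : (m < (n j).-1.+1)%N by rewrite prednK.
  by exists (Ordinal lt_m').
exists [ffun j => xchoose (cX j)] => //.
by apply: eq_bigr => j _; rewrite ffunE; apply/eqP/(xchooseP (cX j)).
Qed.

Theorem theorem1p5 :
  (forall (k : nat) (n : 'I_k -> nat), (forall j, (0 < n j)%N) ->
     mean_gcd_prod n = \sum_(a : prod_Zmod n) (#[a]%g)%:R^-1) /\
  (forall (gT : finGroupType) (G : {group gT}), abelian G ->
     (exists (k : nat) (n : 'I_k -> nat),
        [/\ (0 < k)%N, forall j, (0 < n j)%N & G \isog [set: prod_Zmod n]]) /\
     (forall (k : nat) (n : 'I_k -> nat), (forall j, (0 < n j)%N) ->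
        G \isog [set: prod_Zmod n] ->
        mean_gcd_prod n = \sum_(a in G) (#[a]%g)%:R^-1)).
Proof.
split=> [k n | gT G cGG]; first exact: mean_gcd_prodE.
split=> [|k n n_gt0].
  have [b defG _] := abelian_structure cGG.
  (* A trivial factor keeps the number of factors positive when G = 1. *)
  pose t := in_tuple (1%g :: b).
  exists (size b).+1, (fun j => #[tnth t j]%g).
  split=> //; apply: bigdprod_cycle_isog => //.
  by rewrite -(big_tuple _ _ t xpredT) big_cons cycle1 dprod1g.
(* The isomorphism reindexes the sum over [G] by the product, and injectivity preserves orders. *)
rewrite isog_sym => /isogP[f injf defG]; rewrite mean_gcd_prodE // -defG.
rewrite morphimEdom big_imset /=; last by move=> x y; apply: (injmP injf).
by apply: eq_big => a; rewrite ?inE // => _; rewrite order_injm ?inE.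
Qed.
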